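(* Let $y=s_{i_1}s_{i_2}\cdots s_{i_n}$ be a reduced expression of an element $y\in\tilde W$ with $\ell(y)=n>0$, and for $1\le k\le n$ write $y_k=s_{i_1}\cdots s_{i_k}$. Let $t_y\colon G\to\mathbb C$ be the function defined by $$-q^{\frac{1-n}{2}}t_y=\sum_{k=1}^{n}q^{k-n}\left(\sum_{\substack{w\in\tilde W\\ w\text{ starts with }y_k}}\frac{(-1)^{\ell(w)}q^{-\ell(w)+1}}{1+q}T_w+\sum_{\substack{w\in\tilde W\\ w\text{ does not start with }y_k\\ \ell(w)\ge k}}\frac{(-1)^{\ell(w)+1}q^{-\ell(w)}}{1+q}T_w+\frac{(-1)^kq^{-k+1}}{1+q}\sum_{\substack{w\in\tilde W\\ w\text{ does not start with }y_k\\ \ell(w)<k}}T_w\right).$$ Then $t_y$ lies in the Harish-Chandra Schwartz space $\mathcal C(G)$.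
   Context: $F$ is a non-archimedean local field with ring of integers $\mathcal O$, uniformizer $\pi$, absolute value $|\cdot|$, and residue field of cardinality $q$. $G=\mathrm{SL}_2(F)$, $K=\mathrm{SL}_2(\mathcal O)$, and $I\subset K$ is the Iwahori subgroup of matrices that are upper triangular modulo $\pi$. $\tilde W=\langle s_0,s_1\mid s_0^2=s_1^2=1\rangle$ is the affine Weyl group with length function $\ell$; its elements are lifted to $G$ via $s_0\mapsto\begin{pmatrix}0&-1\\1&0\end{pmatrix}$, $s_1\mapsto\begin{pmatrix}0&\pi^{-1}\\-\pi&0\end{pmatrix}$, and $G=\bigsqcup_{w\in\tilde W}IwI$. $T_w$ denotes the characteristic function of $IwI$. An element $w$ starts with $v$ if a reduced expression of $v$ is an initial segment of a reduced expression of $w$ (the case $w=v$ is allowed). Every $g\in G$ can be written $g=k_1\,\mathrm{diag}(\pi^{\lambda},\pi^{-\lambda})\,k_2$ with $k_1,k_2\in K$ and a unique integer $\lambda=\lambda(g)\ge0$; put $\Delta(g)=q^{\lambda(g)}$ (that is, $q^{\langle\lambda,\rho\rangle}$ with $\rho$ the half-sum of positive roots). The Harish-Chandra Schwartz space $\mathcal C(G)$ is the space of functions $f\colon G\to\mathbb C$ that are bi-invariant under some open compact subgroup and such that for all polynomial functions $p\colon G\to F$ and all $m>0$ there is a constant $C$ (depending on $m$ and $p$) with $$\Delta(g)|f(g)|\le\frac{C}{(\log(1+|p(g)|))^m}\quad\text{for all }g\in G,$$ the right-hand side being read as $+\infty$ where $p(g)=0$. *)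

(* Defs.v *)
From HB Require Import structures.
From mathcomp Require Import all_boot all_order all_algebra.
From mathcomp Require Import all_classical all_reals all_analysis.
From mathcomp Require Import complex.
From mathcomp Require mpoly.

Set Implicit Arguments.
Unset Strict Implicit.
Unset Printing Implicit Defensive.

Import Order.TTheory GRing.Theory Num.Theory.

Local Open Scope classical_set_scope.
Local Open Scope ring_scope.

Definition integer_ring (R : realType) (F : fieldType) (a : F -> R) : set F :=
  [set x | a x <= 1].

Definition maximal_ideal (R : realType) (F : fieldType) (a : F -> R) : set F :=
  [set x | a x < 1].

(** The residue field, as the set of cosets [x + m] with [x] integral. *)
Definition residue_cosets (R : realType) (F : fieldType) (a : F -> R) :
    set (set F) :=
  [set [set x + m | m in maximal_ideal a] | x in integer_ring a].

Definition generates_maximal_ideal (R : realType) (F : fieldType) (a : F -> R)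
    (p : F) : Prop :=
  maximal_ideal a = [set p * c | c in integer_ring a].

(** The absolute value is not normalized: any multiplicative ultrametric one is
    allowed. *)
HB.mixin Record isUltraField (R : realType) F of GRing.Field F := {
  absv : F -> R;
  absv_ge0 : forall x : F, 0 <= absv x;
  absv_eq0 : forall x : F, (absv x == 0) = (x == 0);
  absvM : forall x y : F, absv (x * y) = absv x * absv y;
  absv_ultra : forall x y : F, absv (x + y) <= Num.max (absv x) (absv y)
}.

#[short(type="ultraFieldType")]
HB.structure Definition UltraField (R : realType) :=
  {F of GRing.Field F & isUltraField R F}.

(** [F] with the metric |x - y|.  An alias is needed because the library has no
    join of the field structures with the (pseudo)metric ones. *)
Definition ultra_space (R : realType) (F : ultraFieldType R) : Type := F.

Section UltraMetric.
Variables (R : realType) (F : ultraFieldType R).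

HB.instance Definition _ := Choice.on (ultra_space F).

Definition ultra_dist (x y : ultra_space F) : R :=
  absv ((x : F) - (y : F)).

Fact ultra_distxx x : ultra_dist x x = 0.
Proof. by apply/eqP; rewrite /ultra_dist absv_eq0 subrr. Qed.

Fact ultra_dist_eq0 x y : ultra_dist x y = 0 -> x = y.
Proof. by move/eqP; rewrite absv_eq0 subr_eq0 => /eqP. Qed.

Fact absvN (x : F) : absv (- x) = absv x.
Proof.
have a1 : absv (1 : F) = 1.
  have /eqP := absvM (1 : F) 1; rewrite mulr1 -[X in X == _]mulr1.
  rewrite (inj_eq (mulfI _)) ?absv_eq0 ?oner_eq0//.
  by move/eqP.
have aN1 : absv (-1 : F) = 1.
  have : absv (-1 : F) ^+ 2 = 1 by rewrite expr2 -absvM mulrNN mulr1.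
  by move/eqP; rewrite sqrp_eq1 ?absv_ge0// => /eqP.
by rewrite -mulN1r absvM aN1 mul1r.
Qed.

Fact ultra_dist_sym x y : ultra_dist x y = ultra_dist y x.
Proof. by rewrite /ultra_dist -absvN opprB. Qed.

Fact ultra_dist_triangle y x z :
  ultra_dist x z <= ultra_dist x y + ultra_dist y z.
Proof.
rewrite /ultra_dist -(subrKA (y : F)).
apply: (le_trans (absv_ultra _ _)).
by rewrite ge_max lerDl lerDr !absv_ge0.
Qed.

HB.instance Definition _ := @isMetric.Build R (ultra_space F) ultra_dist
  ultra_distxx ultra_dist_eq0 ultra_dist_sym ultra_dist_triangle.

End UltraMetric.

(** A nonzero generator of the maximal ideal makes the absolute value discrete
    and nontrivial. *)
HB.mixin Record isLocalField (R : realType) F of UltraField R F := {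
  absv_discrete :
    exists2 p : F, p != 0 & generates_maximal_ideal (@absv R F) p;
  absv_residue_finite : finite_set (residue_cosets (@absv R F));
  absv_complete : forall G : set_system (ultra_space F),
    ProperFilter G -> cauchy G -> exists l : ultra_space F, G --> l
}.

#[short(type="localFieldType")]
HB.structure Definition LocalField (R : realType) :=
  {F of UltraField R F & isLocalField R F}.

Definition residue_field (R : realType) (F : localFieldType R) : set (set F) :=
  residue_cosets (@absv R F).
Arguments residue_field {R} F _.

Record uniformizer (R : realType) (F : localFieldType R) := Uniformizer {
  unif_val :> F;
  unif_neq0 : unif_val != 0;
  unif_gen : generates_maximal_ideal (@absv R F) unif_val
}.

Record SL2 (F : fieldType) := MkSL2 {
  sl2_mx :> 'M[F]_2;
  sl2_det : \det sl2_mx == 1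
}.

HB.instance Definition _ (F : fieldType) := [isSub for @sl2_mx F].
HB.instance Definition _ (F : fieldType) := [Choice of SL2 F by <:].

Section SL2_group.
Variable F : fieldType.
Implicit Types g h : SL2 F.

Fact sl2_one_subproof : \det (1%:M : 'M[F]_2) == 1.
Proof. by rewrite det1. Qed.

Definition sl2_one := MkSL2 sl2_one_subproof.

Fact sl2_mul_subproof g h : \det (g *m h) == 1.
Proof. by rewrite det_mulmx (eqP (sl2_det g)) (eqP (sl2_det h)) mulr1. Qed.

Definition sl2_mul g h := MkSL2 (sl2_mul_subproof g h).

Fact sl2_inv_subproof g : \det (invmx g) == 1.
Proof. by rewrite det_inv (eqP (sl2_det g)) invr1. Qed.

Definition sl2_inv g := MkSL2 (sl2_inv_subproof g).

Fact sl2_unitmx g : (g : 'M[F]_2) \in unitmx.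
Proof. by rewrite unitmxE (eqP (sl2_det g)) unitr1. Qed.

Fact sl2_mulA : associative sl2_mul.
Proof. by move=> g h k; apply/val_inj; rewrite /= mulmxA. Qed.

Fact sl2_mul1 : left_id sl2_one sl2_mul.
Proof. by move=> g; apply/val_inj; rewrite /= mul1mx. Qed.

Fact sl2_1mul : right_id sl2_one sl2_mul.
Proof. by move=> g; apply/val_inj; rewrite /= mulmx1. Qed.

Fact sl2_mulV : left_inverse sl2_one sl2_inv sl2_mul.
Proof. by move=> g; apply/val_inj; rewrite /= mulVmx ?sl2_unitmx. Qed.

Fact sl2_Vmul : right_inverse sl2_one sl2_inv sl2_mul.
Proof. by move=> g; apply/val_inj; rewrite /= mulmxV ?sl2_unitmx. Qed.

HB.instance Definition _ := isGroup.Build (SL2 F)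
  sl2_mulA sl2_mul1 sl2_1mul sl2_mulV sl2_Vmul.

End SL2_group.

(** The topology on SL_2(F) is induced from that of the matrices, i.e. of F^4. *)
Definition sl2_space_mx (R : realType) (F : localFieldType R) (g : SL2 F) :
  'M[ultra_space F]_2 := sl2_mx g.

HB.instance Definition _ (R : realType) (F : localFieldType R) :=
  Topological.copy (SL2 F) (initial_topology (@sl2_space_mx R F)).
HB.instance Definition _ (R : realType) (F : localFieldType R) :=
  Uniform.copy (SL2 F) (initial_topology (@sl2_space_mx R F)).
HB.instance Definition _ (R : realType) (F : localFieldType R) :=
  PseudoMetric.copy (SL2 F) (initial_topology (@sl2_space_mx R F)).

Definition mx2 (F : fieldType) (a b c d : F) : 'M[F]_2 :=
  \matrix_(i < 2, j < 2)
    if i == 0 then (if j == 0 then a else b) else (if j == 0 then c else d).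

Fact det_mx2 (F : fieldType) (a b c d : F) : \det (mx2 a b c d) = a * d - b * c.
Proof.
rewrite (expand_det_row _ 0) 2!big_ord_recl big_ord0 addr0 /cofactor !det_mx11.
by rewrite !mxE /= expr0 expr1 mul1r mulN1r mulrN.
Qed.

(** The elements of the affine Weyl group are modelled by the words without two equal consecutive
    letters; multiplication is concatenation followed by cancellation of equal
    neighbours.  Lemma [affW_presentation] states the universal property of
    <s_0, s_1 | s_0^2 = s_1^2 = 1>. *)
Definition alternating (u : seq 'I_2) : bool := sorted (fun a b => a != b) u.

Record affW := AffW { aw_word : seq 'I_2; aw_alt : alternating aw_word }.

HB.instance Definition _ := [isSub for aw_word].
HB.instance Definition _ := [Choice of affW by <:].

Definition cancel_cons (a : 'I_2) (u : seq 'I_2) : seq 'I_2 :=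
  if u is b :: u' then (if a == b then u' else a :: u) else [:: a].

Fact cancel_cons_alt a u : alternating u -> alternating (cancel_cons a u).
Proof.
by case: u => [//|b u] /= hu; case: eqVneq => [_|ab] /=;
  [exact: path_sorted hu | rewrite ab].
Qed.

Fact cancel_consK a u : alternating u -> cancel_cons a (cancel_cons a u) = u.
Proof.
case: u => [|b u] /=; first by rewrite eqxx.
case: eqVneq => [->|ab]; last by rewrite /= eqxx.
by case: u => [//|c u] /= /andP[bc _]; rewrite (negbTE bc).
Qed.

Fact foldr_cancel_alt u v :
  alternating v -> alternating (foldr cancel_cons v u).
Proof. by move=> hv; elim: u => //= a u; exact: cancel_cons_alt. Qed.

Fact foldr_cancel_cons a u v : alternating v ->
  foldr cancel_cons v (cancel_cons a u) = cancel_cons a (foldr cancel_cons v u).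
Proof.
move=> hv; case: u => [//|b u] /=; case: eqVneq => [->|//].
by rewrite cancel_consK// foldr_cancel_alt.
Qed.

Fact foldr_cancel_nil u : alternating u -> foldr cancel_cons [::] u = u.
Proof.
elim: u => [//|a u IH] hu; rewrite [LHS]/= IH; last exact: path_sorted hu.
by case: u hu {IH} => [//|b u] /= /andP[/negbTE ->].
Qed.

Definition aw_one : affW := @AffW [::] isT.
Definition aw_mul (x y : affW) : affW :=
  AffW (foldr_cancel_alt (aw_word x) (aw_alt y)).

Fact aw_inv_subproof (x : affW) : alternating (rev (aw_word x)).
Proof.
rewrite /alternating rev_sorted -(@eq_sorted _ (fun a b => a != b))//.
  exact: aw_alt.
by move=> a b; rewrite eq_sym.
Qed.

Definition aw_inv (x : affW) : affW := AffW (aw_inv_subproof x).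

Fact aw_mulA : associative aw_mul.
Proof.
move=> x y z; apply/val_inj => /=; elim: (aw_word x) => [//|a u IH] /=.
by rewrite foldr_cancel_cons ?aw_alt// IH.
Qed.

Fact aw_mul1 : left_id aw_one aw_mul.
Proof. by move=> x; apply/val_inj. Qed.

Fact aw_1mul : right_id aw_one aw_mul.
Proof. by move=> x; apply/val_inj; rewrite /= foldr_cancel_nil ?aw_alt. Qed.

Fact aw_invK : involutive aw_inv.
Proof. by move=> x; apply/val_inj; rewrite /= revK. Qed.

Fact aw_mulV : left_inverse aw_one aw_inv aw_mul.
Proof.
move=> x; apply/val_inj => /=; have := aw_alt x.
elim: (aw_word x) => [//|a u IH] hu.
rewrite rev_cons -cats1 foldr_cat /= eqxx IH//; exact: path_sorted hu.
Qed.

Fact aw_Vmul : right_inverse aw_one aw_inv aw_mul.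
Proof. by move=> x; rewrite -{1}[x]aw_invK aw_mulV. Qed.

HB.instance Definition _ := isGroup.Build affW
  aw_mulA aw_mul1 aw_1mul aw_mulV aw_Vmul.

Definition aw_gen (a : 'I_2) : affW := @AffW [:: a] isT.

Definition word_prod (u : seq 'I_2) : affW := (\prod_(a <- u) aw_gen a)%g.

Fact word_prod_aw_word (w : affW) : word_prod (aw_word w) = w.
Proof.
apply/val_inj => /=; rewrite -[RHS]foldr_cancel_nil ?aw_alt//.
rewrite /word_prod; elim: (aw_word w) => [|a u IH]; first by rewrite big_nil.
by rewrite big_cons /= IH.
Qed.

Lemma affW_presentation (H : groupType) (h : 'I_2 -> H) :
    (forall a, h a * h a = 1)%g ->
  (forall a, aw_gen a * aw_gen a = 1)%g /\
  exists! f : affW -> H,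
    (forall x y, f (x * y) = f x * f y)%g /\ (forall a, f (aw_gen a) = h a).
Proof.
move=> hh; split; first by move=> a; apply/val_inj; rewrite /= eqxx.
pose f u := (\prod_(a <- u) h a)%g.
have fc a u : (f (cancel_cons a u) = h a * f u)%g.
  rewrite /f; case: u => [|b u] /=; first by rewrite big_cons.
  by case: eqVneq => [->|_]; rewrite !big_cons// mulgA hh mul1g.
exists (fun w => f (aw_word w)); split=> [|f' [f'M f's]].
  split=> [x y /=|a]; last by rewrite /f big_seq1.
  rewrite [in RHS]/f; elim: (aw_word x) => [|a u IH].
    by rewrite big_nil mul1g.
  by rewrite big_cons /= fc IH mulgA.
apply/funext => w; rewrite -[in RHS](word_prod_aw_word w) /word_prod.
elim: (aw_word w) => [|a u IH]; rewrite /f.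
  have := f'M 1%g 1%g; rewrite mulg1 big_nil => f'1.
  by rewrite big_nil; apply: (mulgI (f' 1%g)); rewrite -f'1 mulg1.
by rewrite !big_cons f'M f's -IH.
Qed.

Definition has_word_of_size (w : affW) : pred nat :=
  fun n => `[< exists u : seq 'I_2, word_prod u = w /\ size u = n >].

Fact has_word (w : affW) : exists n, has_word_of_size w n.
Proof.
by exists (size (aw_word w)); apply/asboolP; exists (aw_word w);
  rewrite word_prod_aw_word.
Qed.

Definition ell (w : affW) : nat := ex_minn (has_word w).

Definition reduced_expr (u : seq 'I_2) (w : affW) : Prop :=
  word_prod u = w /\ size u = ell w.

Definition starts_with (w v : affW) : Prop :=
  exists u u' : seq 'I_2, reduced_expr u v /\ reduced_expr (u ++ u') w.

Section Subgroups.
Variables (R : realType) (F : localFieldType R).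

Definition maxcompact : set (SL2 F) :=
  [set g | forall i j, integer_ring (@absv R F) (g i j)].

Definition iwahori : set (SL2 F) :=
  [set g | maxcompact g /\ maximal_ideal (@absv R F) (g 1 0)].

Definition is_subgroup (U : set (SL2 F)) : Prop :=
  [/\ U 1%g, forall g h, U g -> U h -> U (g * h)%g & forall g, U g -> U g^-1%g].

Definition double_coset (U V : set (SL2 F)) (x : SL2 F) : set (SL2 F) :=
  [set (u * x * v)%g | u in U & v in V].

Variable p : uniformizer F.

Fact lift0_subproof : \det (mx2 0 (-1) 1 0 : 'M[F]_2) == 1.
Proof. by rewrite det_mx2 mul0r sub0r mulr1 opprK. Qed.

Fact lift1_subproof : \det (mx2 0 (p : F)^-1 (- (p : F)) 0) == 1.
Proof. by rewrite det_mx2 mul0r sub0r mulrN opprK mulVf ?unif_neq0. Qed.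

Fact diag_subproof (l : nat) :
  \det (mx2 ((p : F) ^+ l) 0 0 ((p : F) ^- l)) == 1.
Proof. by rewrite det_mx2 mul0r subr0 mulfV// expf_neq0// unif_neq0. Qed.

Definition lift_gen (a : 'I_2) : SL2 F :=
  if a == 0 then MkSL2 lift0_subproof else MkSL2 lift1_subproof.

(** [aw_word w] is the unique reduced expression of [w]. *)
Definition lift (w : affW) : SL2 F := (\prod_(a <- aw_word w) lift_gen a)%g.

Definition IwI (w : affW) : set (SL2 F) := double_coset iwahori iwahori (lift w).

(** The sets [IwI w] are pairwise disjoint, so that at each [g] a sum over any
    set of [w] of multiples of these functions has at most one nonzero term. *)
Definition T_ (w : affW) : SL2 F -> R[i] := \1_(IwI w).

Definition diag_pi (l : nat) : SL2 F := MkSL2 (diag_subproof l).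

(** [get] picks an element of the set; here it is the unique [l] of the Cartan decomposition. *)
Definition cartan (g : SL2 F) : nat :=
  get [set l : nat | double_coset maxcompact maxcompact (diag_pi l) g].

Definition poly_function (f : SL2 F -> F) : Prop :=
  exists P : mpoly.mpoly (2 * 2) F,
    forall g : SL2 F, f g = mpoly.meval (fun k => mxvec g 0 k) P.

Definition biinvariant (U : set (SL2 F)) (f : SL2 F -> R[i]) : Prop :=
  forall u g v, U u -> U v -> f (u * g * v)%g = f g.

Variable q : nat.

Definition Delta (g : SL2 F) : R := q%:R ^+ cartan g.

(** The guard [P g != 0] reads the right-hand side as +oo where [P] vanishes;
    the exponent [m] ranges over all positive reals. *)
Definition schwartz_bound (f : SL2 F -> R[i]) : Prop :=
  forall P : SL2 F -> F, poly_function P -> forall m : R, 0 < m ->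
  exists C : R, forall g : SL2 F, P g != 0 ->
    Delta g * Normc.normc (f g) <= C / ln (1 + absv (P g)) `^ m.

Definition schwartz_space : set (SL2 F -> R[i]) :=
  [set f | (exists U : set (SL2 F),
              [/\ is_subgroup U, open U, compact U & biinvariant U f])
         /\ schwartz_bound f].

End Subgroups.

(* Main.v *)
Require Import Defs.
From mathcomp Require Import all_boot all_order all_algebra.
From mathcomp Require Import all_classical all_reals all_analysis.
From mathcomp Require Import complex zify ring lra.
From mathcomp Require mpoly.

(** The function [t] is a combination of the indicators [T_ p w], and each of
    the finitely many coefficients that [T_ p w] receives has absolute value at
    most [q ^- ell w]: the factor [1 / (1 + q)] absorbs the extra [q] in the
    first family, and the third family, where the coefficient does not decay,
    only involves [w] of length less than [k].  Since the double cosets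
    [IwI p w] are disjoint ([IwI_inj]), [t] is bounded on [IwI p w] by a
    constant times [q ^- ell w].

    Every such function is in the Schwartz space ([schwartz_of_decay]).  It is
    invariant under the Iwahori subgroup, which is open and compact
    ([iwahori_open], [iwahori_compact]).  On [IwI p w] the Cartan invariant is
    at most half the length, rounded up ([cartan_IwI]), so that
    [Delta g * |t g|] is at most a constant times [q ^- (ell w)./2].  The matrix
    entries, hence all polynomial functions, grow at most exponentially in
    [ell w] on [IwI p w] ([entry_IwI], [meval_growth]); their logarithms grow at
    most linearly, and every power of a linear function is dominated by
    [q ^+ (ell w)./2] ([log_power_bounded]).

    All that has to be known about the double cosets comes from one function:
    the norm [iw_norm] of a matrix, with suitable weights on the four entries,
    is invariant under the Iwahori subgroup on both sides and takes on [IwI p w]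
    the value [rho ^ (e - 2 * ell w)], where [rho = absv p] and [e] is 1 if [w]
    begins with the letter 0 and 0 otherwise ([iw_norm_IwI]).  This number
    determines [w], because an element is determined by its length and its first
    letter; and it differs from the unweighted norm, which is invariant under
    the maximal compact subgroup, by at most a constant factor. *)

Set Implicit Arguments.
Unset Strict Implicit.
Unset Printing Implicit Defensive.

Import Order.TTheory GRing.Theory Num.Theory.
Import numFieldNormedType.Exports.

Local Open Scope classical_set_scope.
Local Open Scope ring_scope.

(** * The absolute value *)

Section UltraField.
Variables (R : realType) (F : ultraFieldType R).
Implicit Types x y : F.

Lemma absv0 : absv (0 : F) = 0.
Proof. by apply/eqP; rewrite absv_eq0. Qed.

Lemma absv1 : absv (1 : F) = 1.
Proof.
have : absv (1 : F) != 0 by rewrite absv_eq0 oner_eq0.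
by move=> /mulfI; apply; rewrite -absvM !mulr1.
Qed.

Lemma absvV x : absv x^-1 = (absv x)^-1.
Proof.
have [->|x0] := eqVneq x 0; first by rewrite invr0 absv0 invr0.
apply: (@mulfI _ (absv x)); first by rewrite absv_eq0.
by rewrite -absvM !divff ?absv1 // absv_eq0.
Qed.

Lemma absvX x n : absv (x ^+ n) = absv x ^+ n.
Proof.
by elim: n => [|n IH]; rewrite ?expr0 ?absv1 // !exprS absvM IH.
Qed.

Lemma absvD_le x y e : absv x <= e -> absv y <= e -> absv (x + y) <= e.
Proof. by move=> xe ye; rewrite (le_trans (absv_ultra _ _)) // ge_max xe. Qed.

Lemma absvD_lt x y e : absv x < e -> absv y < e -> absv (x + y) < e.
Proof.
by move=> xe ye; rewrite (le_lt_trans (absv_ultra _ _)) // gt_max xe.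
Qed.

Lemma absvD_exp_le c x y n e : 0 <= c ->
  c * absv x ^+ n <= e -> c * absv y ^+ n <= e -> c * absv (x + y) ^+ n <= e.
Proof.
move=> c0 xe ye.
have [xy|/ltW yx] := leP (absv x) (absv y).
  apply: le_trans ye; rewrite ler_wpM2l // lerXn2r ?nnegrE ?absv_ge0 //.
  exact: absvD_le.
apply: le_trans xe; rewrite ler_wpM2l // lerXn2r ?nnegrE ?absv_ge0 //.
exact: absvD_le.
Qed.

End UltraField.

(** * Matrix entries in SL2 *)

Section SL2_entries.
Variable F : fieldType.
Implicit Types (g h : SL2 F) (i j : 'I_2).

Lemma ord2_cases i : i = 0 \/ i = 1.
Proof.
by case: i => [[|[|//]] hi]; [left|right]; apply: val_inj.
Qed.

Lemma sl2_mulE g h i j : (g * h)%g i j = g i 0 * h 0 j + g i 1 * h 1 j.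
Proof.
by rewrite [LHS]mxE !big_ord_recl big_ord0 addr0; congr (_ * _ + g i _ * h _ j);
  apply: val_inj.
Qed.

Lemma sl2_detE g : g 0 0 * g 1 1 - g 0 1 * g 1 0 = 1.
Proof.
rewrite -(eqP (sl2_det g)) -det_mx2; congr (\det _); apply/matrixP => i j.
by rewrite mxE; case: (ord2_cases i) => ->; case: (ord2_cases j) => ->.
Qed.

Lemma sl2_invE g :
  (g^-1)%g = mx2 (g 1 1) (- g 0 1) (- g 1 0) (g 0 0) :> 'M[F]_2.
Proof.
have d : \det (mx2 (g 1 1) (- g 0 1) (- g 1 0) (g 0 0)) == 1.
  by rewrite det_mx2 mulrNN mulrC sl2_detE.
suff -> : (g^-1)%g = MkSL2 d by [].
apply: (mulgI g); rewrite mulgV; apply: val_inj; apply/matrixP => i j.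
have := sl2_detE g => dg.
rewrite [RHS]sl2_mulE !mxE /=.
by case: (ord2_cases i) => ->; case: (ord2_cases j) => -> /=;
  rewrite ?mulr1n ?mulr0n -?dg; ring.
Qed.

End SL2_entries.

(** * Weighted norms constant on double cosets *)

Section WeightedNorm.
Variables (R : realType) (F : localFieldType R).
Implicit Types (g h : SL2 F) (i j : 'I_2) (r s : 'I_2 -> R).

(** The fourth power of the operator norm of [g] between two weighted maximum
    norms on F^2.  With fourth powers the weights that separate the Iwahori
    double cosets are integral powers of [absv p]. *)
Definition weighted_norm r s g : R :=
  \big[Num.max/0]_(ij : 'I_2 * 'I_2)
    (r ij.1 * s ij.2 * absv (g ij.1 ij.2) ^+ 4).

Lemma entry_le_weighted_norm r s g i j :
  r i * s j * absv (g i j) ^+ 4 <= weighted_norm r s g.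
Proof.
exact: (le_bigmax 0
  (fun ij => r ij.1 * s ij.2 * absv (g ij.1 ij.2) ^+ 4) (i, j)).
Qed.

Lemma weighted_norm_le r s g e : 0 <= e ->
  (forall i j, r i * s j * absv (g i j) ^+ 4 <= e) -> weighted_norm r s g <= e.
Proof. by move=> e0 ge; apply: bigmax_le => // -[i j] _; exact: ge. Qed.

Lemma weighted_norm_ge0 r s g : (forall i, 0 <= r i) -> (forall j, 0 <= s j) ->
  0 <= weighted_norm r s g.
Proof.
move=> r0 s0; apply: le_trans (entry_le_weighted_norm r s g 0 0).
by apply: mulr_ge0; [exact: mulr_ge0|exact/exprn_ge0/absv_ge0].
Qed.

(** Says that left multiplication by [c] does not increase the norm of a column
    vector with weights [r]; it only has to be checked entry by entry because
    the absolute value is ultrametric. *)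
Definition weight_contracting (c : 'M[F]_2) r :=
  forall i j, r i * absv (c i j) ^+ 4 <= r j.

Lemma weighted_norm_mull r s g h :
  (forall i, 0 <= r i) -> (forall j, 0 <= s j) -> weight_contracting g r ->
  weighted_norm r s (g * h)%g <= weighted_norm r s h.
Proof.
move=> r0 s0 gr.
apply: weighted_norm_le => [|i j]; first exact: weighted_norm_ge0.
have step l : r i * s j * absv (g i l * h l j) ^+ 4 <= weighted_norm r s h.
  apply: le_trans (entry_le_weighted_norm r s h l j).
  rewrite absvM exprMn mulrACA -[leRHS]mulrA ler_wpM2r //.
  by apply: mulr_ge0 => //; exact/exprn_ge0/absv_ge0.
by rewrite sl2_mulE absvD_exp_le // mulr_ge0.
Qed.

Lemma weighted_norm_mulr r s g h :
  (forall i, 0 <= r i) -> (forall j, 0 <= s j) ->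
  weight_contracting (g : 'M[F]_2)^T s ->
  weighted_norm r s (h * g)%g <= weighted_norm r s h.
Proof.
move=> r0 s0 gs.
apply: weighted_norm_le => [|i j]; first exact: weighted_norm_ge0.
have step l : r i * s j * absv (h i l * g l j) ^+ 4 <= weighted_norm r s h.
  apply: le_trans (entry_le_weighted_norm r s h i l).
  rewrite absvM exprMn mulrACA [leRHS]mulrAC ler_wpM2l //.
    by apply: mulr_ge0 => //; exact/exprn_ge0/absv_ge0.
  by have := gs j l; rewrite mxE.
by rewrite sl2_mulE absvD_exp_le // mulr_ge0.
Qed.

(** Multiplication by [u] and by its inverse both do not increase the norm. *)
Lemma weighted_norm_double_coset (U : set (SL2 F)) r s g x :
  (forall i, 0 <= r i) -> (forall j, 0 <= s j) -> is_subgroup U ->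
  (forall u : SL2 F, U u ->
     weight_contracting u r /\ weight_contracting (u : 'M[F]_2)^T s) ->
  double_coset U U x g -> weighted_norm r s g = weighted_norm r s x.
Proof.
move=> r0 s0 [_ _ UV] Uc [u Uu [v Uv <-]].
have le y a b : U a -> U b ->
    weighted_norm r s (a * y * b)%g <= weighted_norm r s y.
  move=> Ua Ub; apply: le_trans (weighted_norm_mulr _ r0 s0 (Uc _ Ub).2) _.
  exact: weighted_norm_mull (Uc _ Ua).1.
apply/eqP; rewrite eq_le le //=.
have := le (u * x * v)%g _ _ (UV _ Uu) (UV _ Uv).
by rewrite !mulgA mulVg mul1g -!mulgA mulgV mulg1.
Qed.

End WeightedNorm.

(** * The Iwahori norm and the maximum norm *)

Section Uniformizer.
Variables (R : realType) (F : localFieldType R) (p : uniformizer F).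
Notation rho := (absv (p : F)).

Lemma absv_unif_gt0 : 0 < rho.
Proof. by rewrite lt_neqAle absv_ge0 eq_sym absv_eq0 unif_neq0. Qed.

Lemma absv_unif_lt1 : rho < 1.
Proof.
have : maximal_ideal (@absv R F) (p : F); last by [].
by rewrite (unif_gen p); exists 1; rewrite ?mulr1 // /integer_ring /= absv1.
Qed.

(** The value group is discrete: no absolute value is between [rho] and 1. *)
Lemma absv_lt1_le (x : F) : absv x < 1 -> absv x <= rho.
Proof.
move=> x1; have : maximal_ideal (@absv R F) x by [].
rewrite (unif_gen p) => -[c /= c1 <-].
by rewrite absvM ler_piMr // absv_ge0.
Qed.

(** In powers of [rho] the four entries get the weights 0, 1/2, -1/4 and 1/4,
    which are pairwise distinct modulo 1.  The maximum over the entries of a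
    monomial matrix of determinant 1 therefore tells diagonal from antidiagonal
    and which entry is the largest, that is, it determines the absolute values
    of all entries. *)
Definition iw_row (i : 'I_2) : R := if i == 0 then 1 else rho^-1.
Definition iw_col (j : 'I_2) : R := if j == 0 then 1 else rho ^+ 2.
Definition iw_norm : SL2 F -> R := weighted_norm iw_row iw_col.

(** The fourth power of the norm of [g] as an operator on F^2 with the maximum
    norm. *)
Definition max_norm : SL2 F -> R := weighted_norm (fun=> 1) (fun=> 1).

Lemma maxcompact_subgroup : is_subgroup (@maxcompact R F).
Proof.
split=> [i j|g h gK hK i j|g gK i j]; rewrite /integer_ring /=.
- rewrite mxE; case: eqP => _; rewrite ?mulr1n ?mulr0n ?absv1 //.
  by rewrite absv0 ler01.
- rewrite sl2_mulE absvD_le // absvM mulr_ile1 ?absv_ge0 //;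
    by [exact: gK|exact: hK].
- rewrite [X in absv X](_ : _ = (g^-1)%g i j) // sl2_invE mxE.
  by case: ifP => _; case: ifP => _; rewrite ?absvN; exact: gK.
Qed.

Lemma iwahori_subgroup : is_subgroup (@iwahori R F).
Proof.
have [K1 KM KV] := maxcompact_subgroup.
split=> [|g h [gK g10] [hK h10]|g [gK g10]]; split; rewrite /maximal_ideal /=.
- exact: K1.
- by rewrite mxE mulr0n absv0.
- exact: KM.
- rewrite sl2_mulE absvD_lt // absvM.
    by rewrite (le_lt_trans _ g10) // ler_piMr ?absv_ge0 //; exact: hK.
  by rewrite (le_lt_trans _ h10) // ler_piMl ?absv_ge0 //; exact: gK.
- exact: KV.
- by rewrite [X in absv X](_ : _ = (g^-1)%g 1 0) // sl2_invE mxE /= absvN.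
Qed.

Let rho0 := absv_unif_gt0.
Let rho1 := absv_unif_lt1.

(** The only entry whose weight could spoil this is the lower left one, and it
    is divisible by [p] there. *)
Lemma iwahori_contracting (u : SL2 F) : iwahori (R := R) u ->
  weight_contracting u iw_row /\ weight_contracting (u : 'M[F]_2)^T iw_col.
Proof.
move=> [uK u10].
have le1 i j : absv (u i j) ^+ 4 <= 1.
  by rewrite exprn_ile1 ?absv_ge0 //; exact: uK.
have le4 : absv (u 1 0) ^+ 4 <= rho ^+ 4.
  by apply: lerXn2r; rewrite ?nnegrE ?absv_ge0 ?absv_lt1_le.
have rV : 1 <= rho^-1 by rewrite invf_ge1 // ltW.
have r2 : rho ^+ 2 <= 1 by rewrite exprn_ile1 // ltW.
have r20 : 0 <= rho ^+ 2 by rewrite exprn_ge0 // ltW.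
split=> i j; rewrite /iw_row /iw_col ?mxE;
  case: (ord2_cases i) => ->; case: (ord2_cases j) => -> /=.
- by rewrite mul1r.
- by rewrite mul1r (le_trans _ rV).
- rewrite mulrC ler_pdivrMr // mul1r (le_trans le4) //.
  by rewrite exprS ler_piMr ?exprn_ile1 // ltW.
- by rewrite ler_piMr // invr_ge0 ltW.
- by rewrite mul1r.
- by rewrite mul1r (le_trans le4) // (exprD _ 2 2) ler_piMr.
- by apply: mulr_ile1; rewrite ?le1 ?exprn_ge0 ?absv_ge0.
- by rewrite ler_piMr.
Qed.

Lemma iw_row_ge0 i : 0 <= iw_row i.
Proof. by rewrite /iw_row; case: ifP; rewrite ?ler01 // invr_ge0 ltW. Qed.

Lemma iw_col_ge0 j : 0 <= iw_col j.
Proof. by rewrite /iw_col; case: ifP; rewrite ?ler01 // exprn_ge0 // ltW. Qed.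

Lemma iw_norm_double_coset g x :
  double_coset (@iwahori R F) (@iwahori R F) x g -> iw_norm g = iw_norm x.
Proof.
by apply: weighted_norm_double_coset; [exact: iw_row_ge0|exact: iw_col_ge0|
  exact: iwahori_subgroup|exact: iwahori_contracting].
Qed.

Lemma max_norm_double_coset g x :
  double_coset (@maxcompact R F) (@maxcompact R F) x g ->
  max_norm g = max_norm x.
Proof.
apply: weighted_norm_double_coset => //; first exact: maxcompact_subgroup.
by move=> u uK; split=> i j; rewrite mul1r ?mxE exprn_ile1 ?absv_ge0 //;
  exact: uK.
Qed.

Lemma max_norm_le_iw_norm g : max_norm g <= rho ^- 2 * iw_norm g.
Proof.
apply: weighted_norm_le => [|i j].
  by rewrite mulr_ge0 ?invr_ge0 ?exprn_ge0 ?weighted_norm_ge0 //;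
    [exact: ltW|exact: iw_row_ge0|exact: iw_col_ge0].
rewrite !mul1r mulrC ler_pdivlMr ?exprn_gt0 //.
apply: le_trans (entry_le_weighted_norm iw_row iw_col g i j).
rewrite mulrC ler_wpM2r ?exprn_ge0 ?absv_ge0 //.
have rV : 1 <= rho^-1 by rewrite invf_ge1 // ltW.
have r2 : rho ^+ 2 <= 1 by rewrite exprn_ile1 // ltW.
have r20 : 0 <= rho ^+ 2 by rewrite exprn_ge0 // ltW.
rewrite /iw_row /iw_col; do 2 case: ifP => _;
  rewrite ?mul1r ?mulr1 //.
  exact: le_trans rV.
by rewrite ler_peMl.
Qed.

End Uniformizer.

(** * Reduced words *)

Section Words.
Implicit Types (a b : 'I_2) (u v : seq 'I_2) (w : affW).

Lemma size_word_prod u : (size (aw_word (word_prod u)) <= size u)%N.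
Proof.
rewrite /word_prod; elim: u => [|a u IH]; first by rewrite big_nil.
rewrite big_cons /=; case: (aw_word _) IH => [//|b v] /=.
by case: eqP => _ /= h; lia.
Qed.

Lemma ell_size w : ell w = size (aw_word w).
Proof.
rewrite /ell; case: ex_minnP => m /asboolP[u [uw <-]] min.
apply/eqP; rewrite eqn_leq -{2}uw size_word_prod andbT min //.
by apply/asboolP; exists (aw_word w); rewrite word_prod_aw_word.
Qed.

(** There are only two letters, and neighbours differ, so each letter forces the
    next one. *)
Lemma alternating_inj u v : Defs.alternating u -> Defs.alternating v ->
  size u = size v -> (ohead u == Some 0) = (ohead v == Some 0) -> u = v.
Proof.
elim: u v => [|a u IH] [|b v] //= ualt valt [suv] hd.
have eab : a = b.
  move: hd; rewrite !(inj_eq (@Some_inj _)).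
  by case: (ord2_cases a) => ->; case: (ord2_cases b) => ->.
rewrite -eab in valt *; congr cons; apply: IH => //.
- exact: path_sorted ualt.
- exact: path_sorted valt.
case: u v suv ualt valt {hd} => [|c u] [|d v] //= _ /andP[ac _] /andP[ad _].
rewrite !(inj_eq (@Some_inj _)); move: ac ad.
by case: (ord2_cases a) => ->; case: (ord2_cases c) => ->;
  case: (ord2_cases d) => ->.
Qed.

End Words.

(** * Norms on Iwahori double cosets *)

Section LiftNorm.
Variables (R : realType) (F : localFieldType R) (p : uniformizer F).
Notation rho := (absv (p : F)).
Let rho0 := absv_unif_gt0 p.
Let rho1 := absv_unif_lt1 p.
Let rhoN0 : rho != 0 := lt0r_neq0 rho0.
Implicit Types (g : SL2 F) (i : 'I_2) (u : seq 'I_2) (w : affW).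

Lemma unif_expz_le (m n : int) : n <= m -> rho ^ m <= rho ^ n.
Proof.
move=> nm; rewrite -[m]opprK -[n]opprK.
rewrite -(exprz_inv _ (- m)) -(exprz_inv _ (- n)).
by apply: ler_weXz2l; [rewrite invf_ge1 ?(ltW rho1)|rewrite lerN2].
Qed.

(** The contribution of one row to the Iwahori norm, without the weight of the
    row.  Left multiplication by a lifted generator exchanges the rows up to
    scalars, so these two numbers can be computed letter by letter. *)
Definition row_norm g i : R :=
  Num.max (absv (g i 0) ^+ 4) (rho ^+ 2 * absv (g i 1) ^+ 4).

Lemma iw_norm_rows g :
  iw_norm p g = Num.max (row_norm g 0) (rho^-1 * row_norm g 1).
Proof.
have rV0 : 0 <= rho^-1 by rewrite invr_ge0 ltW.
apply/eqP; rewrite eq_le; apply/andP; split.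
  apply: weighted_norm_le => [|i j].
    by rewrite le_max /row_norm le_max exprn_ge0 ?absv_ge0.
  rewrite le_max /row_norm /iw_row /iw_col.
  case: (ord2_cases i) => ->; apply/orP; [left|right].
    rewrite mul1r le_max.
    by case: (ord2_cases j) => -> /=; rewrite ?mul1r lexx ?orbT.
  rewrite -mulrA ler_wpM2l // le_max.
  by case: (ord2_cases j) => -> /=; rewrite ?mul1r lexx ?orbT.
have e i j := entry_le_weighted_norm (iw_row p) (iw_col p) g i j.
rewrite ge_max /row_norm maxr_pMr // !ge_max.
have := e 0 0; have := e 0 1; have := e 1 0; have := e 1 1.
by rewrite /iw_row /iw_col /= !mul1r ?mulr1 !mulrA => -> -> -> ->.
Qed.

Lemma row_norm_lift0 g :
  row_norm (lift_gen p 0%R * g)%g 0 = row_norm g 1 /\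
  row_norm (lift_gen p 0%R * g)%g 1 = row_norm g 0.
Proof.
by rewrite /row_norm !sl2_mulE !mxE /= !mul0r !add0r !addr0 !mulN1r !mul1r
  !absvN.
Qed.

Lemma row_norm_lift1 g :
  row_norm (lift_gen p 1%R * g)%g 0 = rho ^- 4 * row_norm g 1 /\
  row_norm (lift_gen p 1%R * g)%g 1 = rho ^+ 4 * row_norm g 0.
Proof.
rewrite /row_norm !sl2_mulE !mxE /= !mul0r !add0r !addr0 !mulNr !absvN !absvM.
rewrite !absvV !maxr_pMr ?invr_ge0 ?exprn_ge0 ?absv_ge0 // !exprMn !exprVn.
by rewrite !(mulrCA (rho ^+ 2)).
Qed.

(** The two cases overlap at the empty word, where both formulas give the row
    norms of the identity; every left multiplication by the generator that
    keeps the word alternating passes from one case to the other. *)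
Lemma row_norm_lift u : Defs.alternating u ->
  let g := (\prod_(a <- u) lift_gen p a)%g in
  let n := (size u)%:Z in
  (ohead u != Some 1 ->
     row_norm g 0 = rho ^ (2 * n) /\ row_norm g 1 = rho ^ (2 - 2 * n)) /\
  (ohead u != Some 0 ->
     row_norm g 0 = rho ^ (- (2 * n)) /\ row_norm g 1 = rho ^ (2 + 2 * n)).
Proof.
elim: u => [_|a u IH ualt].
  rewrite big_nil /= mulr0 subr0 oppr0.
  rewrite /row_norm !mxE /= absv1 absv0 !expr1n expr0n mulr0 mulr1 expr0z.
  by rewrite (max_idPl ler01) (max_idPr (exprn_ge0 _ (ltW rho0))).
move: (IH (path_sorted ualt)) => /= {IH}.
rewrite big_cons; set g := (\prod_(b <- u) _)%g => -[IH0 IH1].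
have hd b : a = b -> ohead u != Some b.
  move=> <-; case: u ualt {IH0 IH1 g} => [//|c u] /= /andP[ac _].
  by rewrite (inj_eq (@Some_inj _)) eq_sym.
have expE (m n : int) : rho ^ m * rho ^ n = rho ^ (m + n) by rewrite expfzDr.
case: (ord2_cases a) => a_eq; rewrite a_eq; split=> // _.
  have [-> ->] := row_norm_lift0 g; have [-> ->] := IH1 (hd _ a_eq).
  by split; congr (_ ^ _); lia.
have [-> ->] := row_norm_lift1 g; have [-> ->] := IH0 (hd _ a_eq).
have -> : rho ^- 4 = rho ^ (- 4%:Z) by [].
have -> : rho ^+ 4 = rho ^ 4%:Z by [].
by rewrite !expE; split; congr (_ ^ _); lia.
Qed.

(** Minus twice the length, corrected so that the two elements of equal positive
    length get different exponents. *)
Definition iw_exponent w : int :=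
  (ohead (aw_word w) == Some 0)%:Z - 2 * (ell w)%:Z.

Lemma iw_norm_lift w : iw_norm p (Defs.lift p w) = rho ^ iw_exponent w.
Proof.
have expE (m n : int) : rho ^ m * rho ^ n = rho ^ (m + n) by rewrite expfzDr.
have mono (m n : int) : n <= m -> Num.max (rho ^ m) (rho ^ n) = rho ^ n.
  by move=> nm; apply/max_idPr; rewrite unif_expz_le.
rewrite iw_norm_rows /iw_exponent ell_size.
have [h0 h1] := row_norm_lift (aw_alt w).
have -> : rho^-1 = rho ^ (-1) by rewrite exprN1.
case: eqVneq => [hd|/h1[-> ->]] /=.
  have [|-> ->] := h0; first by rewrite hd.
  have : (0 < size (aw_word w))%N by case: (aw_word w) hd.
  by move=> s0; rewrite expE mono; [congr (_ ^ _)|]; lia.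
by rewrite expE maxC mono; [congr (_ ^ _)|]; lia.
Qed.

Lemma iw_norm_IwI w g : IwI p w g -> iw_norm p g = rho ^ iw_exponent w.
Proof. by move=> /iw_norm_double_coset ->; exact: iw_norm_lift. Qed.

(** Disjointness of the Iwahori double cosets: the norm of [g] determines the
    length and the first letter of [w]. *)
Lemma IwI_inj w w' g : IwI p w g -> IwI p w' g -> w = w'.
Proof.
move=> /iw_norm_IwI gw /iw_norm_IwI; rewrite gw.
move=> /(ieexprIz rho0 (negbT (lt_eqF rho1))); rewrite /iw_exponent !ell_size.
move=> e; apply: val_inj; apply: alternating_inj; rewrite ?aw_alt //;
  move: e; do 2 case: (ohead _ == _) => //=; lia.
Qed.

Lemma max_norm_IwI w g : IwI p w g -> max_norm g <= rho ^- (2 * (ell w).+1).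
Proof.
move=> /iw_norm_IwI gw; apply: le_trans (max_norm_le_iw_norm p g) _; rewrite gw.
have -> : rho ^- 2 = rho ^ (- 2%:Z) by [].
have -> : rho ^- (2 * (ell w).+1) = rho ^ (- (2 * (ell w).+1)%:Z).
  by rewrite -exprnN.
rewrite -expfzDr // unif_expz_le // /iw_exponent.
by case: (_ == _) => /=; lia.
Qed.

(** The maximum norm of [diag_pi p l] is the inverse of [rho ^+ l] and does not
    exceed that of [g]. *)
Lemma cartan_IwI w g : IwI p w g -> (cartan p g <= uphalf (ell w))%N.
Proof.
move=> /max_norm_IwI gw; rewrite /cartan.
(* Were there no Cartan decomposition of [g], [get] would return 0. *)
case: xgetP => [l _ gl|//].
have : rho ^- (4 * l) <= rho ^- (2 * (ell w).+1).
  apply: le_trans gw; rewrite (max_norm_double_coset gl).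
  have := entry_le_weighted_norm (fun=> 1) (fun=> 1) (diag_pi p l) 1 1.
  by rewrite !mul1r mxE /= absvV absvX exprVn -exprM mulnC.
rewrite lef_pV2 ?posrE ?exprn_gt0 // ler_iXn2l //.
lia.
Qed.

Lemma entry_IwI w g i (j : 'I_2) :
  IwI p w g -> absv (g i j) <= rho^-1 ^+ (ell w)./2.+1.
Proof.
move=> /max_norm_IwI gw.
rewrite -(@ler_pXn2r _ 4) ?nnegrE ?absv_ge0 ?exprn_ge0 ?invr_ge0 ?(ltW rho0) //.
have := entry_le_weighted_norm (fun=> 1) (fun=> 1) g i j; rewrite !mul1r => gij.
apply: le_trans gij (le_trans gw _); rewrite -exprM exprVn.
rewrite lef_pV2 ?posrE ?exprn_gt0 // ler_wiXn2l // ?ltW //.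
have := odd_double_half (ell w); lia.
Qed.

End LiftNorm.

(** * The Iwahori subgroup is open and compact *)

Section Compactness.
Variables (R : realType) (F : localFieldType R) (p : uniformizer F).
Notation rho := (absv (p : F)).
Let rho0 := absv_unif_gt0 p.
Let rho1 := absv_unif_lt1 p.

Lemma residue_representatives :
  exists s : seq F, forall x : F, absv x <= 1 ->
    exists2 c, c \in s & absv (x - c) <= rho.
Proof.
have /finite_seqP[C CE] := @absv_residue_finite R F.
exists [seq xget 0 A | A <- C] => x x1.
pose A := [set x + m | m in maximal_ideal (@absv R F)].
have AC : A \in C.
  have : [set` C] A by rewrite -CE; exists x.
  by [].
exists (xget 0 A); first exact: map_f.
have : A (xget 0 A).
  apply: (@xgetPex _ 0 A); exists (x + 0); exists 0 => //.
  by rewrite /maximal_ideal /= absv0.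
move=> [m m1 <-]; apply: absv_lt1_le.
by rewrite opprD addrA subrr sub0r absvN.
Qed.

(** Refine a cover of the integers by the finitely many residue classes,
    rescaled by [p ^+ n]. *)
Lemma integer_ring_totally_bounded n :
  exists s : seq F, forall x : F, absv x <= 1 ->
    exists2 c, c \in s & absv (x - c) <= rho ^+ n.
Proof.
have [r rP] := residue_representatives.
elim: n => [|n [s sP]].
  by exists [:: 0] => x x1; exists 0; rewrite ?inE // subr0 expr0.
exists [seq c + (p : F) ^+ n * d | c <- s, d <- r] => x /sP[c cs xc].
have pn0 : (p : F) ^+ n != 0 by rewrite expf_neq0 // unif_neq0.
have [|d dr xd] := rP ((x - c) / (p : F) ^+ n).
  by rewrite absvM absvV absvX ler_pdivrMr ?exprn_gt0 // mul1r.
exists (c + (p : F) ^+ n * d); first by apply/allpairsP; exists (c, d).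
have -> : x - (c + (p : F) ^+ n * d)
        = (p : F) ^+ n * ((x - c) / (p : F) ^+ n - d) by field.
by rewrite absvM absvX exprSr ler_wpM2l // exprn_ge0 // ltW.
Qed.

Lemma ultra_finite_cover (T : Type) (I : eqType) (U : set_system T) (s : seq I)
    (A : I -> set T) :
  UltraFilter U -> U [set t | exists2 c, c \in s & A c t] -> exists c, U (A c).
Proof.
move=> UU; elim: s => [|c s IH] Us.
  exfalso; apply: (@filter_not_empty _ U); apply: filterS Us => t [] //.
have [|UcN] := in_ultra_setVsetC (A c) UU; first by exists c.
apply: IH; apply: filterS (filterI UcN Us) => t [ncA [d]].
by rewrite inE => /predU1P[->//|ds dA]; exists d.
Qed.

(** Total boundedness makes the image ultrafilter Cauchy. *)
Lemma ultra_integer_cvg (T : Type) (U : set_system T) (f : T -> F) :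
  UltraFilter U -> U [set t | absv (f t) <= 1] ->
  exists l, forall e : R, 0 < e -> U [set t | absv (f t - l) < e].
Proof.
move=> UU Uf.
have small (e : R) : 0 < e -> exists n, rho ^+ n < e.
  move=> e0.
  have : (fun n => rho ^+ n : R) @ \oo --> (0 : R).
    by apply: cvg_expr; rewrite ger0_norm ?ltW.
  move=> /cvgrPdist_lt /(_ e e0) [n _ /(_ n (leqnn n)) /=].
  by rewrite sub0r normrN ger0_norm ?exprn_ge0 ?ltW // => ?; exists n.
have UP : ProperFilter (f @ U : set_system (ultra_space F)).
  exact: fmap_proper_filter.
have [|l fl] := @absv_complete R F _ UP.
  apply: cauchy_exP => e e0; have [n ne] := small e e0.
  have [s sP] := integer_ring_totally_bounded n.
  have [|c Uc] := @ultra_finite_cover _ _ U s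
    (fun c => [set t | absv (f t - c) <= rho ^+ n]) UU.
    by apply: filterS Uf => t /= /sP.
  exists c; have : U [set t | @ball R (ultra_space F) c e (f t)]; last by [].
  apply: filterS Uc => t tc.
  by rewrite /ball /= /ultra_dist -absvN opprB; exact: le_lt_trans ne.
exists l => e e0; have /cvg_ballP/(_ e e0) := fl.
apply: filterS => t; rewrite /ball /= /ultra_dist /=.
by rewrite -absvN opprB.
Qed.

Lemma sl2_ballE (g h : SL2 F) (e : R) :
  ball g e h <-> (0 < e /\ forall i j, absv (g i j - h i j) < e).
Proof. by []. Qed.

(** A perturbation of the entries by less than 1 stays in the subgroup. *)
Lemma iwahori_open : open (@iwahori R F).
Proof.
rewrite openE => g [gK g10]; apply/nbhs_ballP; exists 1; first exact: ltr01.
move=> h /sl2_ballE[_ gh].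
have hE i j : h i j = g i j + - (g i j - h i j) by rewrite opprB addrC subrK.
split=> [i j|]; rewrite /integer_ring /maximal_ideal /= hE.
  by apply: absvD_le; [exact: gK|rewrite absvN ltW].
by apply: absvD_lt; rewrite ?absvN.
Qed.

Lemma absv_mul_sub_lt (a b c d : F) e : absv b <= 1 -> absv c <= 1 ->
  absv (a - b) < e -> absv (c - d) < e -> absv (a * c - b * d) < e.
Proof.
move=> b1 c1 ab cd.
have -> : a * c - b * d = (a - b) * c + b * (c - d) by ring.
apply: absvD_lt; rewrite absvM.
  by apply: le_lt_trans ab; rewrite ler_piMr // absv_ge0.
by apply: le_lt_trans cd; rewrite ler_piMl // absv_ge0.
Qed.

(** An ultrafilter on the subgroup converges entry by entry; the limit matrix
    has determinant 1 because the determinant is continuous on integral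
    matrices. *)
Lemma iwahori_compact : compact (@iwahori R F).
Proof.
rewrite compact_ultra => U UU UI.
have entry (ij : 'I_2 * 'I_2) :
    exists l, forall e : R, 0 < e ->
      U [set t : SL2 F | absv (t ij.1 ij.2 - l) < e].
  apply: (@ultra_integer_cvg _ U (fun t : SL2 F => t ij.1 ij.2)).
  by apply: filterS UI => t [tK _]; exact: tK.
have [l lP] := choice entry.
have near (e : R) : 0 < e ->
    U [set t : SL2 F | iwahori (R := R) t /\
                       forall i j, absv (t i j - l (i, j)) < e].
  move=> e0; apply: filterS (filterI UI (filterI
    (filterI (lP (0, 0) e e0) (lP (0, 1) e e0))
    (filterI (lP (1, 0) e e0) (lP (1, 1) e e0)))).
  move=> t [tI [[l00 l01] [l10 l11]]]; split=> // i j.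
  by case: (ord2_cases i) => ->; case: (ord2_cases j) => ->.
have [t1 [[t1K t110] t1l]] := filter_ex (near 1 ltr01).
have lE i j : l (i, j) = t1 i j + - (t1 i j - l (i, j)).
  by rewrite opprB addrC subrK.
have l1 i j : absv (l (i, j)) <= 1.
  by rewrite lE; apply: absvD_le; [exact: t1K|rewrite absvN ltW].
have l10 : absv (l (1, 0)) < 1 by rewrite lE; apply: absvD_lt; rewrite ?absvN.
have det1 : \det (mx2 (l (0, 0)) (l (0, 1)) (l (1, 0)) (l (1, 1))) == 1.
  rewrite det_mx2 -subr_eq0 -absv_eq0; apply: contraT => d0.
  (* Otherwise a matrix of the subgroup whose entries are closer to the limit
     than the error [d] in the determinant has a determinant other than 1. *)
  have {}d0 : 0 < absv (l (0, 0) * l (1, 1) - l (0, 1) * l (1, 0) - 1).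
    by rewrite lt_neqAle eq_sym d0 absv_ge0.
  have [t [[tK _] tl]] := filter_ex (near _ d0).
  move: d0 tl; set d := absv _ => d0 tl; suff : d < d by rewrite ltxx.
  rewrite {1}/d -(sl2_detE t).
  have -> : l (0, 0) * l (1, 1) - l (0, 1) * l (1, 0)
          - (t 0 0 * t 1 1 - t 0 1 * t 1 0)
          = - (t 0 0 * t 1 1 - l (0, 0) * l (1, 1))
            + (t 0 1 * t 1 0 - l (0, 1) * l (1, 0)) by ring.
  by apply: absvD_lt; rewrite ?absvN; apply: absv_mul_sub_lt => //; exact: tK.
exists (MkSL2 det1); split.
  split=> [i j|]; rewrite /integer_ring /maximal_ideal /= mxE //=.
  by case: (ord2_cases i) => ->; case: (ord2_cases j) => -> /=.
apply/fcvg_ballP => e e0; apply: filterS (near e e0) => t [_ tl].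
apply/sl2_ballE; split=> // i j; rewrite -absvN opprB.
suff -> : MkSL2 det1 i j = l (i, j) by [].
by rewrite mxE; case: (ord2_cases i) => ->; case: (ord2_cases j) => ->.
Qed.

End Compactness.

(** * Exponential decay against logarithms of polynomials *)

Section Growth.
Variables (R : realType).

(** The logarithm of [1 + x] grows at most linearly in [j], and a power of a
    linear function of [j] is dominated by [Q ^+ j]. *)
Lemma log_power_bounded (Q m A S : R) : 1 < Q -> 0 < m -> 0 <= A -> 1 <= S ->
  exists2 C, 0 <= C & forall (j : nat) (x : R), 0 <= x -> x <= A * S ^+ j ->
    Q ^- j * ln (1 + x) `^ m <= C.
Proof.
move=> Q1 m0 A0 S1; have Q0 : 0 < Q := lt_trans ltr01 Q1.
have lnQ : 0 < ln Q by exact: ln_gt0.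
pose B := ln (1 + A) + ln S.
have B0 : 0 <= B by rewrite addr_ge0 // ln_ge0 // lerDl.
exists ((B * (m / ln Q)) `^ m * Q) => [|j x x0 xA].
  by rewrite mulr_ge0 ?powR_ge0 // ltW.
have Sj : 1 <= S ^+ j by rewrite exprn_ege1.
have Sj0 : 0 < S ^+ j by exact: lt_le_trans Sj.
have A1 : 0 < 1 + A by lra.
(* The inequality [ln y < y] at this [y] has the factor [j.+1] on the left,
   while the power [m] of [y] is exactly [Q ^+ j.+1]. *)
pose y := Q `^ (j.+1%:R / m).
have ylb : j.+1%:R <= m / ln Q * y.
  have := ln_sublinear (powR_gt0 (j.+1%:R / m) Q0); rewrite ln_powR => /ltW yQ.
  apply: le_trans (_ : m / ln Q * (j.+1%:R / m * ln Q) <= _).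
    by rewrite [leRHS](_ : _ = j.+1%:R) //; field; rewrite !gt_eqF.
  by rewrite ler_wpM2l // divr_ge0 // ltW.
have lnx : ln (1 + x) <= B * (m / ln Q) * y.
  apply: (@le_trans _ _ (B * j.+1%:R)); last by rewrite -mulrA ler_wpM2l.
  apply: (@le_trans _ _ (ln ((1 + A) * S ^+ j))).
    by rewrite ler_ln ?posrE ?mulr_gt0 //; [rewrite mulrDl mul1r lerD|lra].
  rewrite lnM ?posrE // lnXn //; last exact: lt_le_trans S1.
  have a0 : 0 <= ln (1 + A) by rewrite ln_ge0 // lerDl.
  have b0 : 0 <= ln S by rewrite ln_ge0.
  rewrite /B -mulr_natr -natr1.
  have := mulr_ge0 a0 (ler0n R j); lra.
have c0 : 0 <= B * (m / ln Q) by rewrite mulr_ge0 // divr_ge0 // ltW.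
rewrite ler_pdivrMl ?exprn_gt0 //.
apply: le_trans (_ : (B * (m / ln Q) * y) `^ m <= _).
  have y0 : 0 <= y by exact: powR_ge0.
  apply: ge0_ler_powR; [exact: ltW| | |exact: lnx]; rewrite nnegrE.
    by rewrite ln_ge0 // lerDl.
  exact: mulr_ge0.
rewrite powRM ?powR_ge0 // /y -powRrM mulfVK ?gt_eqF //.
by rewrite powR_mulrn ?(ltW Q0) // exprSr mulrCA.
Qed.

Variables (F : ultraFieldType R).

Lemma meval_growth (n : nat) (P : mpoly.mpoly n F) :
  exists A d, 0 <= A /\ forall (x : 'I_n -> F) (B : R), 1 <= B ->
    (forall k, absv (x k) <= B) -> absv (mpoly.meval x P) <= A * B ^+ d.
Proof.
elim/mpoly.mpolyind: P => [|c m P _ _ [A [d [A0 IH]]]].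
  exists 0, 0%N; split=> // x B _ _.
  by rewrite mpoly.meval0 absv0 mul0r.
pose e := (\sum_k mpoly.fun_of_multinom m k)%N.
exists (absv c + A), (e + d)%N; split=> [|x B B1 xB].
  by rewrite addr_ge0 ?absv_ge0.
have B0 : 0 <= B by exact: le_trans B1.
rewrite mpoly.mevalD mpoly.mevalZ mpoly.mevalX exprD.
have Be : 1 <= B ^+ e by exact: exprn_ege1.
have Bd : 1 <= B ^+ d by exact: exprn_ege1.
have xm : absv (\prod_k x k ^+ mpoly.fun_of_multinom m k) <= B ^+ e.
  rewrite /e; elim/big_rec2: _ => [|k b z _ zb]; first by rewrite absv1.
  rewrite absvM exprD ler_pM ?absv_ge0 // absvX.
  by apply: lerXn2r; rewrite ?nnegrE ?absv_ge0.
apply: absvD_le.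
  rewrite absvM mulrDl ler_wpDr ?mulr_ge0 ?exprn_ge0 //.
  rewrite ler_wpM2l ?absv_ge0 // (le_trans xm) // ler_peMr //.
  exact: le_trans Be.
rewrite mulrDl ler_wpDl ?mulr_ge0 ?exprn_ge0 ?absv_ge0 //.
rewrite (le_trans (IH x B B1 xB)) // ler_wpM2l // ler_peMl //.
exact: le_trans Bd.
Qed.

End Growth.

(** * The residue field has at least two elements *)

Section Residue.
Variables (R : realType) (F : localFieldType R).

Lemma residue_card_gt1 q : (residue_field F #= `I_q)%card -> (1 < q)%N.
Proof.
move=> /card_eqPle[/pcard_leP[f] _].
pose A (x : F) := [set x + m | m in maximal_ideal (@absv R F)].
have Ain x : absv x <= 1 -> residue_field F (A x) by move=> x1; exists x.
have A0 : residue_field F (A 0) by apply: Ain; rewrite absv0.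
have A1 : residue_field F (A 1) by apply: Ain; rewrite absv1.
rewrite ltnNge; apply/negP => q1.
have fA : f (A 0) = f (A 1).
  have : (f (A 0%R) < q)%N by exact: (@funS _ _ _ _ f) A0.
  have : (f (A 1%R) < q)%N by exact: (@funS _ _ _ _ f) A1.
  lia.
have /seteqP[_ /(_ 1)] : A 0 = A 1.
  by apply: 'inj_f; rewrite ?inE.
case.
  by exists 0; rewrite ?addr0 // /maximal_ideal /= absv0.
by move=> m m1 e; move: m1; rewrite -[m]add0r e /maximal_ideal /= absv1 ltxx.
Qed.

End Residue.

(** * Sums over Iwahori double cosets *)

Section FSum.
Variables (R : realType) (F : localFieldType R) (p : uniformizer F).

Lemma fsum_IwI (w0 : affW) (g : SL2 F) (A : set affW) (f : affW -> R[i]) :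
  IwI p w0 g -> (forall w, ~ IwI p w g -> f w = 0) ->
  \sum_(w \in A) f w = if w0 \in A then f w0 else 0.
Proof.
move=> w0g f0.
have fw w : w != w0 -> f w = 0.
  by move=> /eqP ww; apply: f0 => wg; apply: ww; exact: IwI_inj wg w0g.
case: ifPn => [|/negP]; rewrite inE => Aw0; last first.
  by apply: fsbig1 => w Aw; apply: fw; apply: contra_notN Aw0 => /eqP <-.
rewrite -(fsbig_widen [set w0]) ?fsbig_set1 // => [w -> //|w [_ /= ww]].
by apply: fw; apply/eqP.
Qed.

Lemma T_in w g : IwI p w g -> T_ p w g = 1 :> R[i].
Proof. by move=> wg; rewrite /T_ indicE mem_set. Qed.

Lemma T_out w g : ~ IwI p w g -> T_ p w g = 0 :> R[i].
Proof. by move=> wg; rewrite /T_ indicE memNset. Qed.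

Lemma T_biinvariant w u g v : iwahori (R := R) u -> iwahori (R := R) v ->
  T_ p w (u * g * v)%g = T_ p w g.
Proof.
have [_ IM IV] := iwahori_subgroup F.
have sub a b h : iwahori (R := R) a -> iwahori (R := R) b ->
    IwI p w h -> IwI p w (a * h * b)%g.
  move=> Ia Ib [c Ic [d Id <-]]; exists (a * c)%g; first exact: IM.
  by exists (d * b)%g; [exact: IM|rewrite !mulgA].
move=> Iu Iv; have [wg|wg] := pselect (IwI p w g).
  by rewrite !T_in //; exact: sub.
rewrite !T_out // => wg'; apply: wg.
have -> : g = (u^-1 * (u * g * v) * v^-1)%g.
  by rewrite !mulgA mulVg mul1g -!mulgA mulgV mulg1.
by apply: sub => //; exact: IV.
Qed.

End FSum.

(** * Decay in the length implies the Schwartz property *)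

Section Decay.
Variables (R : realType) (F : localFieldType R) (p : uniformizer F) (q : nat).
Notation rho := (absv (p : F)).

(** On the double coset of [w] the factor [Delta] grows like the square root of
    [q ^+ ell w], so that half of the decay of [f] is left; it absorbs the
    logarithm, since polynomial functions grow at most exponentially in
    [ell w]. *)
Lemma schwartz_of_decay (f : SL2 F -> R[i]) (D : R) : (1 < q)%N -> 0 <= D ->
  biinvariant (@iwahori R F) f ->
  (forall w g, IwI p w g -> Normc.normc (f g) <= D * q%:R ^- ell w) ->
  (forall g, (forall w, ~ IwI p w g) -> f g = 0) ->
  schwartz_space p q f.
Proof.
move=> q1 D0 fI fw f0; split.
  exists (@iwahori R F); split=> //; first exact: iwahori_subgroup.
    exact: iwahori_open.
  exact: (iwahori_compact p).
move=> P [P' PE] m m0.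
have rho0 := absv_unif_gt0 p; have rho1 := absv_unif_lt1 p.
have rV : 1 <= rho^-1 by rewrite invf_ge1 // ltW.
have [A [d [A0 PA]]] := meval_growth P'.
have Q1 : 1 < q%:R :> R by rewrite ltr1n.
have Q0 : 0 < q%:R :> R by exact: lt_trans Q1.
(* An entry is at most [rho^-1 ^+ j.+1] with [j] half the length; the [.+1] goes
   into the constant [A]. *)
have [||C C0 CP] :=
  log_power_bounded Q1 m0 (A := A * rho^-1 ^+ d) (S := rho^-1 ^+ d).
- by rewrite mulr_ge0 // exprn_ge0 // (le_trans ler01).
- exact: exprn_ege1.
exists (D * C) => g Pg.
have Pg0 : 0 < absv (P g) by rewrite lt_neqAle eq_sym absv_eq0 Pg absv_ge0.
have ln0 : 0 < ln (1 + absv (P g)) by rewrite ln_gt0 // ltrDl.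
rewrite ler_pdivlMr ?powR_gt0 //.
have [[w wg]|no] := pselect (exists w, IwI p w g); last first.
  rewrite f0 ?Normc.normc0 ?mulr0 ?mul0r ?mulr_ge0 // => w wg.
  by apply: no; exists w.
have DL : Delta p q g * Normc.normc (f g) <= D * q%:R ^- (ell w)./2.
  apply: le_trans (_ : q%:R ^+ uphalf (ell w) * (D * q%:R ^- ell w) <= _).
    apply: ler_pM; rewrite ?exprn_ge0 ?ler0n ?fw //.
      by case: (f g) => a b; exact: sqrtr_ge0.
    by rewrite /Delta ler_weXn2l ?(ltW Q1) // cartan_IwI.
  have -> : q%:R ^+ ell w = q%:R ^+ uphalf (ell w) * q%:R ^+ (ell w)./2 :> R.
    rewrite -exprD; congr (_ ^+ _); have := odd_double_half (ell w).
    by rewrite uphalf_half; lia.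
  by rewrite mulrCA invfM mulVKf // expf_neq0 // gt_eqF.
apply: le_trans (ler_wpM2r (powR_ge0 _ _) DL) _.
rewrite -mulrA ler_wpM2l //; apply: CP; first exact: absv_ge0.
rewrite PE; apply: le_trans (PA _ (rho^-1 ^+ (ell w)./2.+1) _ _) _.
- exact: exprn_ege1.
- by move=> k; case/mxvec_indexP: k => i j; rewrite mxvecE; exact: entry_IwI wg.
by rewrite -mulrA -!exprM -exprD -mulnS mulnC.
Qed.

End Decay.

(** * The coefficients of the double cosets *)

Section Coefficients.
Variables (C : numFieldType) (Q : C).
Hypothesis Q1 : 1 <= Q.

Let Q0 : 0 < Q := lt_le_trans ltr01 Q1.

Lemma coeff_start_le l : `|(-1) ^+ l * Q ^ (1 - l%:Z) / (1 + Q)| <= Q ^- l.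
Proof.
have Q1' : 0 < 1 + Q by exact: addr_gt0.
rewrite !normrM normrX normrN1 expr1n mul1r normfV !gtr0_norm ?exprz_gt0 //.
rewrite ler_pdivrMr // expfzDr ?gt_eqF // expr1z mulrC.
rewrite -exprnN ler_wpM2l ?invr_ge0 ?exprn_ge0 ?(ltW Q0) //.
by rewrite lerDr ler01.
Qed.

Lemma coeff_nonstart_le l : `|(-1) ^+ l.+1 * Q ^ (- l%:Z) / (1 + Q)| <= Q ^- l.
Proof.
have Q1' : 0 < 1 + Q by exact: addr_gt0.
rewrite !normrM normrX normrN1 expr1n mul1r normfV !gtr0_norm ?exprz_gt0 //.
rewrite ler_pdivrMr // -exprnN ler_peMr ?invr_ge0 ?exprn_ge0 ?(ltW Q0) //.
by rewrite lerDl ltW.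
Qed.

Lemma coeff_short_le k l : (l < k)%N ->
  `|(-1) ^+ k * Q ^ (1 - k%:Z) / (1 + Q)| <= Q ^- l.
Proof.
move=> lk.
apply: le_trans (_ : `|(-1) ^+ l.+1 * Q ^ (- l%:Z) / (1 + Q)| <= _);
  last exact: coeff_nonstart_le.
rewrite !normrM !normrX !normrN1 !expr1n !mul1r ler_wpM2r //.
rewrite !gtr0_norm ?exprz_gt0 //.
have -> : 1 - k%:Z = - (k.-1)%:Z by lia.
by rewrite -!exprnN lef_pV2 ?posrE ?exprn_gt0 // ler_weXn2l //; lia.
Qed.

End Coefficients.

Local Open Scope complex_scope.

Section Summand.
Variables (R : realType) (F : localFieldType R) (p : uniformizer F).

(** The three index sets partition the affine Weyl group, so that exactly one of
    the three terms survives on the double coset of [w]. *)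
Lemma summand_IwI_le (Q : R[i]) (S : affW -> Prop) (k : nat) w g :
  1 <= Q -> IwI p w g ->
  `| \sum_(w \in [set w | S w])
        ((-1) ^+ ell w * Q ^ (1 - (ell w)%:Z) / (1 + Q)) * T_ p w g
   + \sum_(w \in [set w | ~ S w /\ (k <= ell w)%N])
        ((-1) ^+ (ell w).+1 * Q ^ (- (ell w)%:Z) / (1 + Q)) * T_ p w g
   + ((-1) ^+ k * Q ^ (1 - k%:Z) / (1 + Q)) *
       \sum_(w \in [set w | ~ S w /\ (ell w < k)%N]) T_ p w g | <= Q ^- ell w.
Proof.
move=> Q1 wg; have T0 := @T_out _ _ p.
rewrite !(fsum_IwI _ wg); try by move=> w' /T0 ->; rewrite ?mulr0.
rewrite !(T_in wg) !mulr1.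
have Ql0 : 0 <= Q ^- ell w by rewrite invr_ge0 exprn_ge0 // (le_trans ler01).
have [Sw|Sw] := pselect (S w).
  rewrite mem_set //= !memNset; [|by case|by case].
  by rewrite mulr0 !addr0; exact: coeff_start_le.
rewrite memNset //= add0r.
have [kl|lk] := leqP k (ell w).
  rewrite mem_set //= memNset; last by case=> _; rewrite ltnNge kl.
  by rewrite mulr0 addr0; exact: coeff_nonstart_le.
rewrite memNset; last by case=> _; rewrite leqNgt lk.
by rewrite mem_set // add0r mulr1; exact: coeff_short_le.
Qed.

End Summand.

Theorem proposition3 (R : realType) (F : localFieldType R) (p : uniformizer F)
    (q : nat) (hq : (residue_field F #= `I_q)%card)
    (y : affW) (n : nat) (i : seq 'I_2)
    (hred : reduced_expr i y) (hlen : ell y = n) (hn : (0 < n)%N)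
    (t : SL2 F -> R[i])
    (ht : forall g : SL2 F,
      - (q%:R `^ ((1 - n%:R) / 2))%:C * t g =
      \sum_(1 <= k < n.+1) q%:R ^ (k%:Z - n%:Z) *
        (\sum_(w \in [set w | starts_with w (word_prod (take k i))])
            ((-1) ^+ ell w * q%:R ^ (1 - (ell w)%:Z) / (1 + q%:R)) * T_ p w g
       + \sum_(w \in [set w | ~ starts_with w (word_prod (take k i)) /\
                              (k <= ell w)%N])
            ((-1) ^+ (ell w).+1 * q%:R ^ (- (ell w)%:Z) / (1 + q%:R)) * T_ p w g
       + ((-1) ^+ k * q%:R ^ (1 - k%:Z) / (1 + q%:R)) *
          \sum_(w \in [set w | ~ starts_with w (word_prod (take k i)) /\
                               (ell w < k)%N]) T_ p w g)) :
  schwartz_space p q t.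
Proof.
have q1 := residue_card_gt1 hq.
set c := q%:R `^ _ in ht.
have c0 : 0 < c by rewrite powR_gt0 // ltr0n; lia.
have cC0 : - c%:C != 0 :> R[i] by rewrite oppr_eq0 eq_complex /= gt_eqF.
have Q1 : 1 <= q%:R :> R[i] by rewrite ler1n; lia.
have Q0 : 0 < q%:R :> R[i] by exact: lt_le_trans Q1.
have ht' g := canRL (mulKf cC0) (ht g).
apply: (schwartz_of_decay (D := n%:R / c)) => //.
- by rewrite divr_ge0 // ltW.
- move=> u g v Iu Iv; apply: (mulfI cC0); rewrite !ht.
  apply: eq_bigr => k _; congr (_ * (_ + _ + _ * _));
    by apply: eq_fsbigr => w _; rewrite T_biinvariant.
- move=> w g wg.
  (* The norm of R[i] is by definition the image of [Normc.normc] in R[i]. *)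
  rewrite -lecR [leLHS](_ : _ = `|t g|); last by [].
  have -> : (n%:R / c * q%:R ^- ell w)%:C
          = c%:C^-1 * (n%:R * q%:R ^- ell w) :> R[i].
    by rewrite mulrAC mulrC !rmorphM !fmorphV rmorphXn !rmorph_nat.
  have cN : `|c%:C| = c%:C by rewrite ger0_norm // lecR ltW.
  rewrite ht' normrM normfV normrN cN ler_wpM2l ?invr_ge0 ?lecR ?(ltW c0) //.
  apply: le_trans (ler_norm_sum _ _ _) _.
  have -> : n%:R * q%:R ^- ell w
          = \sum_(1 <= k < n.+1) q%:R ^- ell w :> R[i].
    by rewrite sumr_const_nat subn1 mulr_natl.
  rewrite big_nat [leRHS]big_nat; apply: ler_sum => k /andP[_ kn].
  rewrite normrM -[leRHS]mul1r ler_pM //; last exact: summand_IwI_le.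
  rewrite ger0_norm ?exprz_ge0 ?(ltW Q0) //.
  have -> : k%:Z - n%:Z = - (n - k)%N%:Z by lia.
  by rewrite -exprnN invf_le1 ?exprn_gt0 // exprn_ege1.
move=> g no; apply: (mulfI cC0); rewrite ht mulr0.
apply: big1 => k _; rewrite !fsbig1; first by rewrite mulr0 !addr0 mulr0.
all: by move=> w _; rewrite T_out ?mulr0.
Qed.
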